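(* Let $m\ge 2$ and let $X$ and $Y$ be Banach spaces. Then $$\tilde a_n(P)\le a_n(P^{**})+2\widetilde{\gamma}(P)$$ for all $n\in\mathbb{N}$ and all $P\in\mathcal{P}(^mX;Y)$.
   Context: Banach spaces are over $\mathbb{K}=\mathbb{R}$ or $\mathbb{C}$; $\mathbb{N}$ is the set of positive integers. $\mathcal{P}(^mX;Y)$ is the Banach space of continuous $m$-homogeneous polynomials $P:X\to Y$, i.e. maps $P(x)=A(x,\ldots,x)$ with $A:X\times\cdots\times X\to Y$ a continuous $m$-linear map, with norm $\|P\|=\sup\{\|P(x)\|:\|x\|\le 1\}$; $\mathcal{P}(^mX)=\mathcal{P}(^mX;\mathbb{K})$ and $\mathcal{L}(X;Y)=\mathcal{P}(^1X;Y)$. The rank of $P$ is the dimension of the linear span of $P(X)$ in $Y$. The $n$-th approximation number of $P\in\mathcal{P}(^mX;Y)$ is $\tilde a_n(P)=\inf\{\|P-Q\|: Q\in\mathcal{P}(^mX;Y),\ \mathrm{rank}(Q)<n\}$; for a linear operator $T\in\mathcal{L}(X;Y)$, $a_n(T)=\inf\{\|T-L\|: L\in\mathcal{L}(X;Y),\ \mathrm{rank}(L)<n\}$. The adjoint of $P$ is the continuous linear operator $P^*:Y^*\to\mathcal{P}(^mX)$, $P^*(\varphi)(x)=\varphi(P(x))$, and $P^{**}=(P^* )^*:\mathcal{P}(^mX)^*\to Y^{**}$ is the usual adjoint of the linear operator $P^*$. For a bounded subset $A$ of a metric space, $\beta(A)=\inf\{\varepsilon>0: A$ may be covered by finitely many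 balls (of the ambient metric space) of radius $\le\varepsilon\}$, and $\widetilde{\gamma}(P)=\beta(P(\overline{B}_X))$, with ambient space $Y$, where $\overline{B}_X$ is the closed unit ball of $X$. *)

(* Defs.v *)
From HB Require Import structures.
From mathcomp Require Import all_boot all_order all_algebra.
From mathcomp Require Import complex.
From mathcomp Require Import all_classical all_reals topology normedtype.

Set Implicit Arguments.
Unset Strict Implicit.
Unset Printing Implicit Defensive.

Import Order.TTheory GRing.Theory Num.Theory.
Import numFieldNormedType.Exports.

Local Open Scope classical_set_scope.
Local Open Scope ring_scope.

Inductive scalar_kind := real_scalars | complex_scalars.

(* The scalar field K, either R or C.  Norms of a [normedModType K] are
   K-valued: for K = C they lie in the real half-line of C, and the order of C
   (z <= w iff w - z is a nonnegative real) restricts to the usual order there. *)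
Definition scalars (R : realType) (k : scalar_kind) : numFieldType :=
  match k with real_scalars => R | complex_scalars => R[i] end.

Section Supremum.
Context {R : realType} {k : scalar_kind}.
Local Notation K := (scalars R k).

Lemma scalars_supremums (A : set K) (b : K) :
  A !=set0 -> (forall x, A x -> 0 <= x) -> ubound A b -> supremums A !=set0.
Proof.
case: k A b => [|] /= A b [a Aa] A0 Ab.
  have hA : has_sup A by split; [exists a|exists b].
  exists (sup A); split; first exact: (sup_upper_bound hA).
  by move=> y yub; apply: ge_sup => //; exists a.
pose B : set R := [set complex.Re z | z in A].
have AB z : A z -> (complex.Re z)%:C%C = z.
  by move=> /A0; rewrite lecE /= => /andP[/eqP + _]; case: z => x y /= ->.
have hB : has_sup B.
  split; first by exists (complex.Re a), a.
  exists (complex.Re b) => _ [z Az <-].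
  by move: (Ab z Az); rewrite lecE => /andP[].
exists ((sup B)%:C%C); split => [z Az|y yub].
  rewrite -(AB z Az) lecR; apply: (sup_upper_bound hB); by exists z.
have : complex.Im y = 0 /\ sup B <= complex.Re y.
  split; first by have := yub a Aa; rewrite -{1}(AB a Aa) lecE /= => /andP[/eqP].
  apply: ge_sup; first by case: hB.
  by move=> _ [z Az <-]; have := yub z Az; rewrite lecE => /andP[].
by move=> [yi yr]; rewrite lecE /= yi eqxx.
Qed.

Lemma scalars_infimums (A : set K) :
  A !=set0 -> (forall x, A x -> 0 <= x) -> infimums A !=set0.
Proof.
move=> [a Aa] A0.
pose L := [set x : K | 0 <= x /\ lbound A x].
have [s [sL sle]] : supremums L !=set0.
  apply: (@scalars_supremums L a) => [|x []//|x [_]]; last exact.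
  by exists 0.
have s0 : 0 <= s by exact: sL.
exists s; split=> [x Ax|y yA]; first by apply: sle => z [_]; exact.
have [y0|ny0] := boolP (0 <= y); first exact: sL.
have yr : y \is Num.real by rewrite (ler_real (yA _ Aa)) ger0_real // A0.
by rewrite (le_trans _ s0) // ltW // real_ltNge.
Qed.

End Supremum.

Lemma continuous_lincomb (K : numFieldType) (T : topologicalType)
    (Y : normedModType K) (a : K) (f g : T -> Y) :
  continuous f -> continuous g -> continuous (fun x => a *: f x + g x).
Proof.
move=> fc gc x; apply: cvgD; last exact: gc.
by apply: cvgZl_tmp; exact: fc.
Qed.

Section HomogeneousPolynomials.
Context {K : numFieldType} (m : nat) (X Y : normedModType K).

Definition multilinear (A : ('I_m -> X) -> Y) :=
  forall (i : 'I_m) (x : 'I_m -> X), linear (fun u : X => A (dfwith x i u)).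

(* [{ptws 'I_m -> X}] is X^m with the product topology. *)
Definition is_hpoly (P : X -> Y) :=
  exists A : {ptws 'I_m -> X} -> Y,
    [/\ multilinear A, continuous A & forall x, P x = A (fun=> x)].

Definition hpoly_pred : {pred X -> Y} := [pred P | `[< is_hpoly P >]].

(* The space P(^m X; Y) of continuous m-homogeneous polynomials. *)
Record hpoly := HPoly {hpoly_fun :> X -> Y; _ : hpoly_fun \in hpoly_pred}.

HB.instance Definition _ := [isSub for hpoly_fun].
HB.instance Definition _ := [Choice of hpoly by <:].

Lemma hpolyP (P : hpoly) : is_hpoly P.
Proof. by case: P => P /= /asboolP. Qed.

Definition mk_hpoly (P : X -> Y) (hP : is_hpoly P) : hpoly :=
  HPoly (asboolT hP : P \in hpoly_pred).

Lemma hpolyE (P Q : hpoly) : (forall x, P x = Q x) -> P = Q.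
Proof. by move=> PQ; apply/val_inj/funext. Qed.

Lemma hpoly_submod_closed : submod_closed hpoly_pred.
Proof.
split.
  apply/asboolP; exists (fun=> 0); split => //; last exact: cst_continuous.
  by move=> i x a u v; rewrite scaler0 addr0.
move=> a P Q /asboolP[A [Al Ac PA]] /asboolP[B [Bl Bc QB]]; apply/asboolP.
exists (fun x => a *: A x + B x); split.
- move=> i x c u v /=; rewrite Al Bl !scalerDr !scalerA (mulrC a) -!addrA.
  by congr (_ + _); rewrite addrCA.
- exact: continuous_lincomb.
- by move=> x; rewrite -PA -QB.
Qed.

HB.instance Definition _ :=
  GRing.isSubmodClosed.Build _ _ hpoly_pred hpoly_submod_closed.
HB.instance Definition _ := [SubChoice_isSubLmodule of hpoly by <:].

(* The supremum exists over K = R or C, see [hpoly_norm_supremums]. *)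
Definition hpoly_norm (P : hpoly) : K :=
  supremum 0 [set `|P x| | x in [set x : X | `|x| <= 1]].

End HomogeneousPolynomials.

Section HomogeneousTheory.
Context {K : numFieldType} {m : nat} {X Y : normedModType K}.
Implicit Types P : hpoly m X Y.

Lemma diag_continuous : continuous (fun x : X => (fun=> x) : {ptws 'I_m -> X}).
Proof.
move=> x; apply/cvg_sup => i.
have /= := @continuous_comp_initial _ _ _ (fun f : 'I_m -> X => f i)
  (fun (y : X) (_ : 'I_m) => y).
by apply => y; exact: cvg_id.
Qed.

Lemma hpoly_continuous P : continuous P.
Proof.
have [A [_ Ac PA]] := hpolyP P.
rewrite (_ : hpoly_fun P = A \o (fun x => (fun=> x))); last exact/funext.
by move=> x; apply: continuous_comp; [exact: diag_continuous|exact: Ac].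
Qed.

Lemma hpolyZ P (a : K) (x : X) : P (a *: x) = a ^+ m *: P x.
Proof.
have [A [Al _ PA]] := hpolyP P; rewrite !PA.
have AZ (i : 'I_m) (y : 'I_m -> X) (u : X) :
      A (dfwith y i (a *: u)) = a *: A (dfwith y i u).
  have A0 : A (dfwith y i 0) = 0.
    by have := Al i y (-1) 0 0; rewrite scaleN1r oppr0 addr0 scaleN1r addNr.
  by have := Al i y a u 0; rewrite addr0 A0 addr0.
pose f j : 'I_m -> X := fun i => if (i < j)%N then a *: x else x.
have fE j : (j <= m)%N -> A (f j) = a ^+ j *: A (fun=> x).
  elim: j => [_|j IH jm]; first by rewrite expr0 scale1r; congr A; exact/funext.
  pose i := Ordinal jm.
  have -> : f j.+1 = dfwith (f j) i (a *: x).
    apply/funext => l; have [->|il] := eqVneq l i.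
      by rewrite dfwithin /f /= ltnSn.
    rewrite dfwithout 1?eq_sym // /f ltnS leq_eqVlt.
    by rewrite (_ : (l == j :> nat) = false) //; apply/negbTE.
  rewrite AZ (_ : dfwith _ _ _ = f j).
    by rewrite IH ?(ltnW jm) // scalerA exprS.
  apply/funext => l; have [->|il] := eqVneq l i.
    by rewrite dfwithin /f /= ltnn.
  by rewrite dfwithout 1?eq_sym.
by rewrite -fE //; congr A; apply/funext => i; rewrite /f ltn_ord.
Qed.

Lemma hpoly0 P : (0 < m)%N -> P 0 = 0.
Proof.
move=> m0; have := hpolyZ P 0 0.
by rewrite scale0r expr0n eqn0Ngt m0 scale0r.
Qed.

Lemma hpoly_bounded P :
  exists2 M : K, 0 <= M & forall x, `|P x| <= M * `|x| ^+ m.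
Proof.
have /cvgr_dist_lt /(_ _ ltr01) := @hpoly_continuous P 0.
move=> /nbhs_norm0P[d /= d0 Pd].
have M0 : 0 <= (2 / d) ^+ m * (`|P 0| + 1).
  by rewrite mulr_ge0 ?addr_ge0 ?exprn_ge0 ?divr_ge0 // ltW.
exists ((2 / d) ^+ m * (`|P 0| + 1)) => // x.
have [->|x0] := eqVneq x 0.
  have [m0|m0] := posnP m; last first.
    by rewrite hpoly0 // !normr0 expr0n eqn0Ngt m0 mulr0.
  have e0 (z : K) : z ^+ m = 1 by rewrite [in LHS]m0.
  by rewrite !e0 mulr1 mul1r lerDl.
pose r := (d / 2) / `|x|.
have nx0 : 0 < `|x| by rewrite normr_gt0.
have r0 : 0 < r by rewrite !divr_gt0.
have -> : P x = r^-1 ^+ m *: P (r *: x).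
  by rewrite -hpolyZ scalerA mulVf ?scale1r // gt_eqF.
have -> : r^-1 = (2 / d) * `|x| by rewrite /r invf_div invf_div mulrC.
rewrite normrZ normrX ger0_norm; last by rewrite mulr_ge0 ?divr_ge0 // ltW.
rewrite exprMn -!mulrA ler_wpM2l ?exprn_ge0 ?divr_ge0 //; first exact: ltW.
rewrite mulrC ler_wpM2r ?exprn_ge0 //.
have : `|P 0 - P (r *: x)| < 1.
  apply: Pd => /=; rewrite normrZ gtr0_norm // /r divfK ?gt_eqF //.
  by rewrite ltr_pdivrMr // ltr_pMr // ltr1n.
move=> /ltW h; rewrite -[P (r *: x)](subrK (P 0)) addrC.
by rewrite (le_trans (ler_normD _ _)) // lerD2l distrC.
Qed.

End HomogeneousTheory.

Section HomogeneousNorm.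
Context {R : realType} {k : scalar_kind}.
Local Notation K := (scalars R k).
Context {m : nat} {X Y : normedModType K}.
Implicit Types P Q : hpoly m X Y.

Let values P : set K := [set `|P x| | x in [set x : X | `|x| <= 1]].

Let values_neq0 P : values P !=set0.
Proof. by exists `|P 0|, 0 => //=; rewrite normr0. Qed.

Lemma hpoly_norm_supremums P : supremums (values P) (hpoly_norm P).
Proof.
rewrite /hpoly_norm /supremum -/(values P) ifF; last first.
  by apply/negbTE/set0P/values_neq0.
have [M M0 PM] := hpoly_bounded P.
have [s sP] : supremums (values P) !=set0.
  apply: (@scalars_supremums _ _ _ M) => [||_ [x /= x1 <-]].
  - exact: values_neq0.
  - by move=> _ [x _ <-].
  - by rewrite (le_trans (PM x)) // ler_piMr // exprn_ile1.
by case: xgetP => [y -> //|/(_ s)].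
Qed.

Lemma hpoly_norm_ub P x : `|x| <= 1 -> `|P x| <= hpoly_norm P.
Proof. by move=> x1; apply: (hpoly_norm_supremums P).1; exists x. Qed.

Lemma hpoly_norm_le P (b : K) :
  (forall x, `|x| <= 1 -> `|P x| <= b) -> hpoly_norm P <= b.
Proof. by move=> Pb; apply: (hpoly_norm_supremums P).2 => _ [x /Pb + <-]. Qed.

Lemma hpoly_normP P x : `|P x| <= hpoly_norm P * `|x| ^+ m.
Proof.
have [x0|x0] := eqVneq `|x| 0.
  have [m0|m0] := posnP m.
    have e0 (z : K) : z ^+ m = 1 by rewrite [in LHS]m0.
    by rewrite e0 mulr1; apply: hpoly_norm_ub; rewrite x0.
  move/eqP: x0; rewrite normr_eq0 => /eqP ->.
  by rewrite hpoly0 // !normr0 expr0n eqn0Ngt m0 mulr0.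
have nx0 : 0 < `|x| by rewrite lt_neqAle eq_sym x0 normr_ge0.
rewrite -ler_pdivrMr ?exprn_gt0 //.
have := @hpoly_norm_ub P (`|x|^-1 *: x).
rewrite hpolyZ !normrZ normrX normfV normr_id mulVf // exprVn mulrC.
exact.
Qed.

Let hpoly_normD P Q : hpoly_norm (P + Q) <= hpoly_norm P + hpoly_norm Q.
Proof.
apply: hpoly_norm_le => x x1; rewrite (le_trans (ler_normD _ _)) //.
by rewrite lerD // hpoly_norm_ub.
Qed.

Let hpoly_norm0_eq0 P : hpoly_norm P = 0 -> P = 0.
Proof.
move=> P0; apply: hpolyE => x; apply/normr0_eq0/le_anti.
by rewrite normr_ge0 (le_trans (hpoly_normP P x)) // P0 mul0r.
Qed.

Let hpoly_normZ_le (a : K) P : hpoly_norm (a *: P) <= `|a| * hpoly_norm P.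
Proof.
apply: hpoly_norm_le => x x1.
by rewrite [X in `|X|](_ : _ = a *: P x) // normrZ ler_wpM2l // hpoly_norm_ub.
Qed.

Let hpoly_normZ (a : K) P : hpoly_norm (a *: P) = `|a| * hpoly_norm P.
Proof.
apply/le_anti; rewrite hpoly_normZ_le /=.
have [->|a0] := eqVneq a 0.
  have := @hpoly_norm_ub (0 *: P) 0; rewrite !normr0 mul0r => /(_ ler01).
  exact: le_trans.
rewrite -{1}[P]scale1r -(mulVf a0) -scalerA.
by rewrite -ler_pdivlMl ?normr_gt0 // -normfV hpoly_normZ_le.
Qed.

HB.instance Definition _ := Lmodule_isNormed.Build K (hpoly m X Y)
  hpoly_normD hpoly_normZ hpoly_norm0_eq0.

Lemma hpoly_normE P :
  `|P| = supremum 0 [set `|P x| | x in [set x : X | `|x| <= 1]].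
Proof. by []. Qed.

End HomogeneousNorm.

(* L(X; Y) is P(^1 X; Y); in particular the dual of V is [hpoly 1 V K^o]. *)
Lemma is_hpoly1P (K : numFieldType) (X Y : normedModType K) (f : X -> Y) :
  is_hpoly 1 f <-> linear f /\ continuous f.
Proof.
split=> [hf|[fl fc]].
  split; last first.
    exact (@hpoly_continuous _ _ _ _ (mk_hpoly hf)).
  have [A [Al _ fA]] := hf; move=> a u v.
  have fE z : f z = A (dfwith (fun=> 0 : X) (ord0 : 'I_1) z).
    by rewrite fA; congr A; apply/funext => i; rewrite !ord1 dfwithin.
  by rewrite !fE Al.
exists (fun x => f (x ord0)); split=> [i x a u v|x|//].
  by rewrite !ord1 !dfwithin fl.
have px : continuous (fun y : {ptws 'I_1 -> X} => y ord0).
  exact: (@proj_continuous _ (fun=> X) ord0).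
exact: (@continuous_comp _ _ _ (fun y : {ptws 'I_1 -> X} => y ord0) f x
  (px x) (fc _)).
Qed.

Lemma hpoly1_linear (K : numFieldType) (X Y : normedModType K)
  (f : hpoly 1 X Y) : linear f.
Proof. by have /is_hpoly1P[] := hpolyP f. Qed.

Section Adjoint.
Context {R : realType} {k : scalar_kind}.
Local Notation K := (scalars R k).
Context {m : nat} {X Y : normedModType K}.

Lemma is_hpoly_comp (P : hpoly m X Y) (phi : hpoly 1 Y K^o) :
  is_hpoly m (fun x => phi (P x)).
Proof.
have [A [Al Ac PA]] := hpolyP P.
exists (fun x => phi (A x)); split=> [i x a u v|x|x]; last by rewrite PA.
  by rewrite Al hpoly1_linear.
exact: (@continuous_comp _ _ _ A phi x (Ac x) (@hpoly_continuous _ _ _ _ phi _)).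
Qed.

Definition adjoint_fun (P : hpoly m X Y) (phi : hpoly 1 Y K^o) :
  hpoly m X K^o := mk_hpoly (is_hpoly_comp P phi).

Lemma is_hpoly_adjoint (P : hpoly m X Y) : is_hpoly 1 (adjoint_fun P).
Proof.
have al : linear (adjoint_fun P) by move=> a phi psi; exact: hpolyE.
apply/is_hpoly1P; split=> //.
pose L := GRing.isLinear.Build K _ _ _ (adjoint_fun P) al.
pose T : {linear hpoly 1 Y K^o -> hpoly m X K^o} :=
  HB.pack (adjoint_fun P) L.
apply: (@bounded_linear_continuous K _ _ T).
apply/linear_boundedP; near=> r => phi /=.
apply: hpoly_norm_le => x x1 /=.
rewrite (le_trans (hpoly_normP phi _)) // expr1 mulrC.
rewrite ler_wpM2r //; first exact: (normr_ge0 phi).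
rewrite (le_trans (hpoly_norm_ub P x1)) //.
by near: r; apply: nbhs_pinfty_ge; exact: (@normr_real _ _ P).
Unshelve. all: by end_near. Qed.

(* P^* : Y^* -> P(^m X), phi |-> phi o P.  Since P^* is a 1-homogeneous
   polynomial, [adjoint (adjoint P)] is P^** : P(^m X)^* -> Y^**. *)
Definition adjoint (P : hpoly m X Y) : hpoly 1 (hpoly 1 Y K^o) (hpoly m X K^o) :=
  mk_hpoly (is_hpoly_adjoint P).

End Adjoint.

Section Rank.
Context {K : numFieldType} {V : lmodType K}.

Definition linear_span (S : set V) : set V :=
  [set v | exists (d : nat) (c : 'I_d -> K) (s : 'I_d -> V),
     (forall i, S (s i)) /\ v = \sum_(i < d) c i *: s i].

Definition linearly_independent (d : nat) (e : 'I_d -> V) :=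
  forall c : 'I_d -> K, \sum_(i < d) c i *: e i = 0 -> forall i, c i = 0.

Definition has_dim (W : set V) (d : nat) :=
  exists e : 'I_d -> V, linearly_independent e /\ linear_span (range e) = W.

End Rank.

Section Quantities.
Context {R : realType} {k : scalar_kind}.
Local Notation K := (scalars R k).

Definition rank_lt (m : nat) (X Y : normedModType K) (P : hpoly m X Y)
    (n : nat) :=
  exists2 d : nat, (d < n)%N & has_dim (linear_span (range P)) d.

(* For m = 1 this is the n-th approximation number of a linear operator. *)
Definition approx_number (m : nat) (X Y : normedModType K) (n : nat)
    (P : hpoly m X Y) : K :=
  infimum 0 [set `|P - Q| | Q in [set Q : hpoly m X Y | rank_lt Q n]].

(* The balls are open; closed balls give the same [ball_noncompactness]. *)
Definition ball_coverable (Y : normedModType K) (A : set Y) (e : K) :=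
  exists s : seq (Y * K),
    (forall p, p \in s -> 0 < p.2 <= e) /\
    A `<=` \bigcup_(p in [set` s]) ball p.1 p.2.

Definition ball_noncompactness (Y : normedModType K) (A : set Y) : K :=
  infimum 0 [set e : K | 0 < e /\ ball_coverable A e].

Definition gamma_tilde (m : nat) (X Y : normedModType K) (P : hpoly m X Y) : K :=
  ball_noncompactness (P @` [set x : X | `|x| <= 1]).

End Quantities.

(* Main.v *)
(* A bounded linear map [L] of rank less than [n] close to [P^**] has the form
   [L xi = \sum_j L xi (t j) *: w j] with [t j] in [Y^*] and [w j] in [Y^**].
   Composing with the evaluations [x |-> eval_at x] of P(^m X), which form a
   continuous homogeneous polynomial, gives scalar polynomials
   [q j x = L (eval_at x) (t j)], and [P x] is close in [Y^**] to
   [\sum_j q j x *: w j].  It remains to replace the [w j] by vectors [z j] of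
   [Y].  In place of the full principle of local reflexivity, Helly's theorem
   suffices: finitely many norm constraints
   [`|y i - \sum_j c i j *: w j| <= r i] with [y i] in [Y] can be satisfied in
   [Y] up to a factor [1 + eta].  The [y i] are the centers of finitely many
   balls covering the image of the unit ball, and the [c i] range over a finite
   net for the bounded vectors [q x].  Passing from [P x] to [y i] and back costs
   the radius twice, whence the factor [2]. *)

From HB Require Import structures.
Require Import Defs.
From mathcomp Require Import all_boot all_order all_algebra.
From mathcomp Require Import complex.
From mathcomp Require Import all_classical all_reals topology normedtype.
From mathcomp Require Import ring lra.

Set Implicit Arguments.
Unset Strict Implicit.
Unset Printing Implicit Defensive.

Import Order.TTheory GRing.Theory Num.Theory.
Import numFieldNormedType.Exports.
Local Open Scope ring_scope.
Local Open Scope classical_set_scope.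

(** * The Hahn-Banach theorem over R and C *)

Section HahnBanach.
Context {R : realType} {K : nzRingType} (iota : {rmorphism R -> K}).
Context {V : lmodType K} (p : V -> R).
Hypothesis pD : forall x y, p (x + y) <= p x + p y.
Hypothesis pZ : forall (a : R) x, 0 <= a -> p (iota a *: x) = a * p x.
Variable v0 : V.

(* Graphs of partial [R]-linear functionals below [p]; invariance under
   translation by multiples of [(v0, p v0)] forces the value at [v0], while
   still allowing the empty graph, which is the union of the empty chain. *)
Let good (A : set (V * R)) :=
  [/\ forall a u v, A u -> A v -> A (iota a *: u.1 + v.1, a * u.2 + v.2),
      forall a u, A u -> A (iota a *: v0 + u.1, a * p v0 + u.2)
    & forall u, A u -> u.2 <= p u.1].

Let p0 : p 0 = 0.
Proof. by have := pZ 0 (lexx 0); rewrite rmorph0 scale0r mul0r; exact. Qed.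

Let good_line : good [set (iota a *: v0, a * p v0) | a in [set: R]].
Proof.
split.
- move=> a _ _ [b _ <-] [c _ <-]; exists (a * b + c) => //=.
  by rewrite rmorphD rmorphM scalerDl scalerA mulrDl mulrA.
- move=> a _ [b _ <-]; exists (a + b) => //=.
  by rewrite rmorphD scalerDl mulrDl.
- move=> _ [a _ <-] /=; have [a0|/ltW a0] := leP 0 a; first by rewrite pZ.
  have := pD (iota a *: v0) (iota (- a) *: v0).
  rewrite [p (iota (- a) *: _)]pZ ?oppr_ge0 // rmorphN scaleNr subrr p0.
  by lra.
Qed.

(** Zorn's lemma on graphs ordered by inclusion; a maximal graph is total because it can be extended
    by one dimension. The morphism [iota] also covers complex spaces regarded as real ones. *)
Lemma hahn_banach_real : exists g : V -> R,
  [/\ forall x y, g (x + y) = g x + g y,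
      forall a x, g (iota a *: x) = a * g x,
      forall x, g x <= p x & g v0 = p v0].
Proof.
have [F Fgood Ftot|A [Agood Amax]] := @Zorn_bigcup _ good.
  split=> [a u v [B FB Bu] [C FC Cv]|a u [B FB Bu]|u [B FB Bu]].
  - have [BC|CB] := Ftot _ _ FB FC.
      by exists C => //; have [+ _ _] := Fgood _ FC; apply=> //; exact: BC.
    by exists B => //; have [+ _ _] := Fgood _ FB; apply=> //; exact: CB.
  - by exists B => //; have [_ + _] := Fgood _ FB; apply.
  - by have [_ _] := Fgood _ FB; apply.
have [Alin Av Ap] := Agood.
have A0 : A (0, 0).
  (* The empty graph is not maximal, since [good_line] extends it; any point [u] of [A] then gives
     [(0, 0)] as [- u + u]. *)
  suff [u Au] : A !=set0.
    by have := Alin (-1) u u Au Au; rewrite rmorphN1 scaleN1r mulN1r !addNr.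
  apply: contrapT => /set0P/negP; rewrite negbK => /eqP A0.
  apply: (Amax _ _ good_line); rewrite A0; split=> // /(_ (0, 0)) /=.
  by apply; exists 0; rewrite // rmorph0 scale0r mul0r.
have Adom x0 : exists r, A (x0, r).
  apply: contrapT => nAx0.
  (* A value at [x0] must lie above all of [L] and below every [p (u.1 + x0) - u.2]; by
     subadditivity [sup L] does. *)
  pose L := [set u.2 - p (u.1 - x0) | u in A].
  have Lub u : A u -> ubound L (p (u.1 + x0) - u.2).
    move=> Au _ [v Av' <-]; have := Alin 1 _ _ Au Av'.
    rewrite rmorph1 scale1r mul1r => /Ap /=.
    have := pD (u.1 + x0) (v.1 - x0); rewrite addrACA subrr addr0.
    by lra.
  have supL : has_sup L.
    by split; [exists (0 - p (0 - x0)), (0, 0)|exists (p (0 + x0) - 0);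
      exact: (Lub _ A0)].
  pose s := sup L.
  have sle u : A u -> s <= p (u.1 + x0) - u.2.
    by move=> Au; apply: ge_sup (Lub _ Au); case: supL.
  have les u : A u -> u.2 - p (u.1 - x0) <= s.
    by move=> Au; apply: (sup_upper_bound supL); exists u.
  pose B := [set (iota a.1 *: x0 + a.2.1,
    a.1 * s + a.2.2) | a in [set a : R * (V * R) | A a.2]].
  have Alin0 a u : A u -> A (iota a *: u.1, a * u.2).
    by move=> Au; have := Alin a _ _ Au A0; rewrite !addr0.
  apply: (Amax B).
    split=> [u Au|BA].
      by exists (0, u) => //=; rewrite rmorph0 scale0r mul0r !add0r
        -surjective_pairing.
    apply: nAx0; exists s; apply: BA; exists (1, (0, 0)) => //=.
    by rewrite rmorph1 scale1r mul1r !addr0.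
  split.
  - move=> c _ _ [[a u] /= Au <-] [[b v] /= Av' <-] /=.
    exists (c * a + b, (iota c *: u.1 + v.1, c * u.2 + v.2)) => /=;
      first exact: Alin.
    rewrite rmorphD rmorphM !scalerDl scalerDr scalerA.
    by congr pair; [rewrite addrACA|ring].
  - move=> c _ [[a u] /= Au <-] /=.
    exists (a, (iota c *: v0 + u.1, c * p v0 + u.2)) => /=; first exact: Av.
    by congr pair; rewrite addrCA.
  - move=> _ [[a u] /= Au <-] /=.
    have [a0|a0|->] := ltgtP a 0; last first.
    + by rewrite rmorph0 scale0r mul0r !add0r; exact: Ap.
    + have -> : iota a *: x0 + u.1 = iota a *: (iota a^-1 *: u.1 + x0).
        by rewrite scalerDr scalerA -(rmorphM iota) mulfV ?gt_eqF //
          rmorph1 scale1r addrC.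
      rewrite pZ ?(ltW a0) ?(ltW b0) // -ler_pdivrMl // mulrDr mulKf ?gt_eqF //.
      by have := sle _ (Alin0 a^-1 _ Au); rewrite /=; lra.
    + have b0 : 0 < - a by rewrite oppr_gt0.
      have -> : iota a *: x0 + u.1 = iota (- a) *: (iota (- a)^-1 *: u.1 - x0).
        rewrite scalerBr scalerA -(rmorphM iota) mulfV ?gt_eqF //
          rmorph1 scale1r.
        by rewrite rmorphN scaleNr opprK addrC.
      rewrite pZ ?(ltW a0) ?(ltW b0) // -ler_pdivrMl // mulrDr.
      have -> : (- a)^-1 * (a * s) = - s.
        by rewrite -[a in _ * (a * s)]opprK mulNr mulrN mulKf ?gt_eqF.
      by have := les _ (Alin0 (- a)^-1 _ Au); rewrite /=; lra.
have [g gA] := choice Adom.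
have Auniq x r s : A (x, r) -> A (x, s) -> r = s.
  have le y a b : A (y, a) -> A (y, b) -> a <= b.
    move=> Aa Ab; have := Alin (-1) _ _ Ab Aa.
    by rewrite rmorphN1 scaleN1r mulN1r /= addNr => /Ap /=; rewrite p0; lra.
  by move=> Ar As; apply/le_anti; rewrite !(le x).
exists g; split=> [x y|a x|x|].
- apply: (Auniq (x + y)) => //.
  by have := Alin 1 _ _ (gA x) (gA y); rewrite rmorph1 scale1r mul1r.
- apply: (Auniq (iota a *: x)) => //.
  by have := Alin a _ _ (gA x) A0; rewrite !addr0.
- exact: Ap (gA x).
- apply: (Auniq v0) => //.
  by have := Av 1 _ A0; rewrite rmorph1 scale1r mul1r !addr0.
Qed.

End HahnBanach.

(** Over C, the real theorem is applied to the real part of [q]; the resulting [g] is the real part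
    of the complex functional [g x - i g (i x)]. *)
Lemma hahn_banach (R : realType) (k : scalar_kind)
    (V : lmodType (scalars R k)) (q : V -> scalars R k) (v0 : V) :
    (forall x, 0 <= q x) -> (forall x y, q (x + y) <= q x + q y) ->
    (forall a x, q (a *: x) = `|a| * q x) ->
  exists f : V -> scalars R k,
    [/\ linear (f : V -> (scalars R k)^o),
        forall x, `|f x| <= q x & f v0 = q v0].
Proof.
case: k V q v0 => /= V q v0 q0 qD qZ.
  have qZ0 (a : R) x : 0 <= a -> q (a *: x) = a * q x.
    by move=> a0; rewrite qZ ger0_norm.
  have [g [gD gZ gq gv]] := @hahn_banach_real R R idfun V q qD qZ0 v0.
  exists g; split=> // [a x y|x]; first by rewrite gD gZ.
  by rewrite ler_norml gq lerNl -mulN1r -gZ /= andbT (le_trans (gq _)) //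
    qZ normrN1 mul1r.
pose p x := complex.Re (q x).
have qE x : q x = (p x)%:C%C.
  by move: (q0 x); rewrite /p lecE /=; case: (q x) => a b /= /andP[/eqP ->].
have pD x y : p (x + y) <= p x + p y.
  by have := qD x y; rewrite !qE -rmorphD lecR.
have pZ (a : R) x : 0 <= a -> p (a%:C%C *: x) = a * p x.
  move=> a0; have := qZ a%:C%C x; rewrite !qE ger0_norm ?lecR // -rmorphM.
  by move=> /complexI.
have [g [gD gZ gp gv]] := @hahn_banach_real R R[i] (real_complex R) V p pD pZ
  v0.
pose f x := (g x +i* - g ('i *: x))%C.
have gN x : g (- x) = - g x.
  by have := gZ (-1) x; rewrite rmorphN1 scaleN1r mulN1r.
have fD x y : f (x + y) = f x + f y.
  by rewrite /f scalerDr !gD opprD.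
have fZ a x : f (a *: x) = a * f x.
  case: a => a b; rewrite /f.
  have -> : (a +i* b)%C *: x = a%:C%C *: x + b%:C%C *: ('i *: x).
    rewrite scalerA -scalerDl; congr (_ *: _).
    by apply/eqP; rewrite eq_complex /=; apply/andP; split; apply/eqP; ring.
  have -> : 'i *: (a%:C%C *: x + b%:C%C *: ('i *: x)) =
            a%:C%C *: ('i *: x) - b%:C%C *: x.
    by rewrite scalerDr !scalerA mulrC (mulrC 'i b%:C%C) -mulrA -expr2 sqrCi
      mulrN1 scaleNr.
  rewrite !gD gN !gZ; apply/eqP; rewrite eq_complex /=.
  by apply/andP; split; apply/eqP; ring.
have fq x : `|f x| <= q x.
  have [->|fx0] := eqVneq (f x) 0; first by rewrite normr0.
  (* The unimodular [u] makes [f (u *: x)] real, hence equal to [g (u *: x)], which [p] bounds. *)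
  pose u := `|f x| / f x.
  have u1 : `|u| = 1 by rewrite normrM normfV normr_id mulfV // normr_eq0.
  have fux : f (u *: x) = `|f x| by rewrite fZ mulfVK.
  rewrite -[q x]mul1r -u1 -qZ -fux.
  have : 0 <= f (u *: x) by rewrite fux.
  rewrite qE lecE /= => /andP[/eqP i0 _]; rewrite lecE /= i0 eqxx /=; exact: gp.
exists f; split=> //; first by move=> a x y; rewrite fD fZ.
(* The real part of [f v0] already equals [q v0], so this bound forces the imaginary part to
   vanish. *)
have : `|f v0| ^+ 2 <= q v0 ^+ 2 by rewrite ler_sqr ?nnegrE.
rewrite -add_Re2_Im2 qE -rmorphXn lecR /= gv sqrrN gerDl => i0.
have /eqP : g ('i *: v0) ^+ 2 = 0 by apply/le_anti; rewrite i0 sqr_ge0.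
by rewrite sqrf_eq0 /f gv => /eqP ->; rewrite oppr0.
Qed.

(** * Linear combinations and bounded linear maps *)

Lemma linear_lincomb (K : nzRingType) (V W : lmodType K) (f : V -> W)
    (I : Type) (r : seq I) (c : I -> K) (v : I -> V) :
  linear f -> f (\sum_(i <- r) c i *: v i) = \sum_(i <- r) c i *: f (v i).
Proof.
move=> fl; elim: r => [|i r IH]; last by rewrite !big_cons fl IH.
rewrite !big_nil; apply: (addIr (f 0)); rewrite add0r.
by have := fl 1 0 0; rewrite !scale1r addr0.
Qed.

Section LinearMaps.
Context {K : numFieldType}.

Lemma is_hpoly1_bounded (X Y : normedModType K) (f : X -> Y) (M : K) :
  linear f -> 0 <= M -> (forall x, `|f x| <= M * `|x|) -> is_hpoly 1 f.
Proof.
move=> fl M0 fM; apply/is_hpoly1P; split=> //.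
pose L := GRing.isLinear.Build K _ _ _ f fl.
pose T : {linear X -> Y} := HB.pack f L.
apply: (@bounded_linear_continuous K _ _ T).
apply/linear_boundedP; near=> r => x /=.
rewrite (le_trans (fM x)) // ler_wpM2r //.
by near: r; apply: nbhs_pinfty_ge; exact: ger0_real.
Unshelve. all: by end_near. Qed.

Lemma hpoly_lincombE (m : nat) (X Y : normedModType K) (I : Type) (r : seq I)
    (c : I -> K) (Q : I -> hpoly m X Y) (x : X) :
  (\sum_(i <- r) c i *: Q i) x = \sum_(i <- r) c i *: Q i x.
Proof.
elim: r => [|i r IH]; first by rewrite !big_nil.
by rewrite !big_cons -IH.
Qed.

End LinearMaps.

(** * Infima of nonnegative scalars *)

Section Infimum.
Context {R : realType} {k : scalar_kind}.
Local Notation K := (scalars R k).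
Variables (A : set K) (A_neq0 : A !=set0) (A_ge0 : forall x, A x -> 0 <= x).

Lemma infimum_infimums : infimums A (infimum 0 A).
Proof.
rewrite /infimum ifF; last exact/negbTE/set0P.
by have [s sA] := scalars_infimums A_neq0 A_ge0;
  case: xgetP => [y -> //|/(_ s)].
Qed.

Lemma infimum_le x : A x -> infimum 0 A <= x.
Proof. by move=> Ax; have [h _] := infimum_infimums; apply: h. Qed.

Lemma le_infimum (b : K) : (forall x, A x -> b <= x) -> b <= infimum 0 A.
Proof. by move=> Ab; have [_] := infimum_infimums; apply. Qed.

Lemma infimum_ge0 : 0 <= infimum 0 A.
Proof. exact: le_infimum. Qed.

Lemma infimum_lt (b : K) : infimum 0 A < b -> exists2 x, A x & x < b.
Proof.
move=> Ab; apply: contrapT => nAb.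
(* Over C the order is partial; [b] and the members of [A] are comparable because they are
   nonnegative. *)
have b0 : 0 <= b by rewrite ltW // (le_lt_trans infimum_ge0).
have : b <= infimum 0 A.
  apply: le_infimum => x Ax; rewrite real_leNgt ?ger0_real ?(A_ge0 Ax) //.
  by apply/negP => xb; apply: nAb; exists x.
by move=> /(lt_le_trans Ab); rewrite ltxx.
Qed.

End Infimum.

(** * Helly's theorem in the bidual *)

Section Helly.
Context {R : realType} {k : scalar_kind}.
Local Notation K := (scalars R k).
Context {Y : normedModType K}.
Local Notation Ystar := (hpoly 1 Y K^o).

Lemma hpoly_norm_gt (psi : Ystar) (eta : K) : 0 < eta ->
  exists2 w, `|w| <= 1 & `|psi| - eta < `|psi w|.
Proof.
move=> eta0; apply: contrapT => nw.
have : `|psi| <= `|psi| - eta.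
  apply: hpoly_norm_le => w w1; rewrite real_leNgt ?normr_real //.
    by apply/negP => h; apply: nw; exists w.
  by rewrite realB ?normr_real // gtr0_real.
by rewrite lerDl oppr_ge0 => /(lt_le_trans eta0); rewrite ltxx.
Qed.

Context {I J : finType}.
Variables (y : I -> Y) (c : I -> J -> K) (e : J -> hpoly 1 Ystar K^o).
Variables (r : I -> K) (s : K).
Hypothesis r_gt0 : forall i, 0 < r i.
Hypothesis s_gt1 : 1 < s.
Hypothesis dual_bound : forall i (psi : Ystar),
  `|psi (y i) - \sum_j c i j * e j psi| <= r i * `|psi|.

Let V := {ffun I -> Y}.
(* [q] is the norm [max_i `|z i| / r i] on [Y^I] modulo the range of
   [u |-> (\sum_j c i j *: u j)_i]; a functional below [q] is a family of
   functionals on [Y] annihilating that range. *)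
Let G (z : V) : set K := [set t | 0 <= t /\
  exists u : J -> Y, forall i, `|z i - \sum_j c i j *: u j| <= t * r i].
Let q z : K := infimum 0 (G z).

Let G0 z t : G z t -> 0 <= t. Proof. by case. Qed.

Let G_cst (z : V) t : 0 <= t -> (forall i, `|z i| <= t * r i) -> G z t.
Proof.
move=> t0 zt; split=> //; exists (fun=> 0) => i.
by rewrite big1 ?subr0 // => j _; rewrite scaler0.
Qed.

Let G_neq0 z : G z !=set0.
Proof.
have t0 i : 0 <= `|z i| / r i by rewrite divr_ge0 // ltW.
exists (\sum_i `|z i| / r i); apply: G_cst => [|i]; first exact: sumr_ge0.
rewrite -ler_pdivrMr // (bigD1 i) //= lerDl; exact: sumr_ge0.
Qed.

Let q_le z t : G z t -> q z <= t.
Proof. by move=> Gz; apply: infimum_le => // x /G0. Qed.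

Let le_q z b : (forall t, G z t -> b <= t) -> b <= q z.
Proof. by move=> h; apply: le_infimum => // x /G0. Qed.

Let q0 z : 0 <= q z.
Proof. by apply: le_q => t /G0. Qed.

Let qD z w : q (z + w) <= q z + q w.
Proof.
rewrite -lerBlDl; apply: le_q => t Gt; rewrite lerBlDl -lerBlDr.
apply: le_q => t' Gt'; rewrite lerBlDr.
apply: q_le; move: Gt Gt' => [t0 [u ut]] [t0' [u' ut']].
split; first exact: addr_ge0.
exists (fun j => u' j + u j) => i.
under eq_bigr do rewrite scalerDr.
rewrite big_split /= ffunE opprD addrACA (le_trans (ler_normD _ _)) //.
by rewrite mulrDl lerD.
Qed.

Let GZ a z t : G z t -> G (a *: z) (`|a| * t).
Proof.
move=> [t0 [u ut]]; split; first exact: mulr_ge0.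
exists (fun j => a *: u j) => i.
have -> : (a *: z) i - \sum_j c i j *: (a *: u j) =
  a *: (z i - \sum_j c i j *: u j).
  rewrite ffunE scalerBr scaler_sumr; congr (_ - _).
  by apply: eq_bigr => j _; rewrite !scalerA mulrC.
by rewrite normrZ -mulrA ler_wpM2l.
Qed.

Let qZ_le a z : q (a *: z) <= `|a| * q z.
Proof.
have [->|a0] := eqVneq a 0.
  rewrite scale0r normr0 mul0r; apply: q_le; apply: G_cst => // i.
  by rewrite ffunE normr0 mul0r.
rewrite -ler_pdivrMl ?normr_gt0 //; apply: le_q => t Gt.
by rewrite ler_pdivrMl ?normr_gt0 //; apply/q_le/GZ.
Qed.

Let qZ a z : q (a *: z) = `|a| * q z.
Proof.
apply/le_anti; rewrite qZ_le /=.
have [->|a0] := eqVneq a 0; first by rewrite normr0 mul0r.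
rewrite -{1}[z]scale1r -(mulVf a0) -scalerA.
by rewrite -ler_pdivlMl ?normr_gt0 // -normfV qZ_le.
Qed.

Let single (i : I) (w : Y) : V := [ffun l => if l == i then w else 0].

Let single_sum (z : V) : z = \sum_i 1 *: single i (z i).
Proof.
apply/ffunP => l; rewrite sum_ffunE (bigD1 l) //= scale1r ffunE eqxx.
by rewrite big1 ?addr0 // => i il; rewrite scale1r ffunE eq_sym (negbTE il).
Qed.

(** If [q] were at least [s] at the data, Hahn-Banach would give functionals [psi i] with
    [\sum_i c i j *: psi i = 0]. The [e j] terms then cancel in [f y'], so [dual_bound] bounds the
    sum of the norms of the [psi i] with weights [r i] below by [s]; but a functional dominated by
    [q] has weighted sum at most [1]. *)
Lemma helly_bidual :
  exists z : J -> Y, forall i, `|y i - \sum_j c i j *: z j| <= s * r i.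
Proof.
have s0 : 0 < s by exact: lt_trans s_gt1.
pose y' : V := [ffun i => y i].
have [qs|] := boolP (q y' < s).
  have [//|t /G0//|t [t0 [u ut]] ts] := infimum_lt _ _ qs.
  exists u => i; have := ut i; rewrite ffunE => /le_trans; apply.
  by rewrite ler_wpM2r ?(ltW ts) // ltW.
rewrite -real_leNgt ?ger0_real ?(ltW s0) // => sq.
have [f [fl fq fy]] := hahn_banach y' q0 qD qZ.
have singlel i : linear (single i).
  move=> a u v; apply/ffunP => l; rewrite !ffunE.
  by case: eqP => // _; rewrite scaler0 addr0.
have psi_hp i : is_hpoly 1 ((fun w => f (single i w)) : Y -> K^o).
  apply: (@is_hpoly1_bounded _ _ _ _ (r i)^-1).
  - by move=> a u v; rewrite singlel fl.
  - by rewrite invr_ge0 ltW.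
  - move=> w; apply: (le_trans (fq _)); apply/q_le/G_cst => [|l].
      by rewrite mulr_ge0 // invr_ge0 ltW.
    rewrite ffunE; case: eqP => [->|_];
      first by rewrite mulrAC mulVf ?gt_eqF // mul1r.
    by rewrite normr0 !mulr_ge0 // ?invr_ge0 ltW.
pose psi i : Ystar := mk_hpoly (psi_hp i).
have fE z : f z = \sum_i psi i (z i).
  rewrite {1}[z]single_sum (linear_lincomb _ _ _ fl).
  by apply: eq_bigr => i _; rewrite scale1r.
(* The family of the [c i j *: w] lies in the range divided out by [q], so [q], and with it [f],
   vanishes there. *)
have cpsi j : \sum_i c i j *: psi i = 0.
  apply: hpolyE => w.
  have -> : (\sum_i c i j *: psi i : Ystar) w = f [ffun i => c i j *: w].
    rewrite fE; under [RHS]eq_bigr do rewrite ffunE.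
    rewrite hpoly_lincombE; apply: eq_bigr => i _.
    by rewrite hpolyZ expr1.
  apply/eqP; rewrite -normr_eq0; apply/eqP/le_anti; rewrite normr_ge0 andbT.
  apply: (le_trans (fq _)); apply: q_le; split=> //.
  exists (fun l => if l == j then w else 0) => i.
  rewrite ffunE (bigD1 j) //= eqxx big1 ?addr0 ?subrr ?normr0 ?mul0r // => l lj.
  by rewrite (negbTE lj) scaler0.
have fy' : f y' = \sum_i (psi i (y i) - \sum_j c i j * e j (psi i)).
  rewrite sumrB exchange_big /= fE.
  under [X in X = _]eq_bigr do rewrite ffunE.
  rewrite [X in _ - X]big1 ?subr0 // => j _.
  rewrite -(linear_lincomb _ _ _ (@hpoly1_linear _ _ _ (e j))) cpsi.
  exact: hpoly0.
have fr : s <= \sum_i r i * `|psi i|.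
  rewrite (le_trans sq) // -fy -(ger0_norm (_ : 0 <= f y')) ?fy //.
  by rewrite -fy fy' (le_trans (ler_norm_sum _ _ _)) // ler_sum.
pose S := \sum_i r i.
have S0 : 0 <= S by apply: sumr_ge0 => i _; exact: ltW.
(* Nearly attaining the norms of the [psi i] up to [eta] costs at most [eta * S], which is less than
   [s - 1 = eta * (1 + S)]. *)
pose eta := (s - 1) / (1 + S).
have S1 : 0 < 1 + S by rewrite ltr_pwDl.
have eta0 : 0 < eta by rewrite divr_gt0 // subr_gt0.
have [w /all_and2[w1 weta]] := choice (fun i =>
  let: ex_intro2 w a b := hpoly_norm_gt (psi i) eta0 in ex_intro _ w (conj a
    b)).
(* Unimodular factors align the summands (the factor is 0 when [psi i (w i)]
   vanishes). *)
pose z : V := [ffun i => (r i * (`|psi i (w i)| / psi i (w i))) *: w i].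
have fz : f z = \sum_i r i * `|psi i (w i)|.
  rewrite fE; apply: eq_bigr => i _; rewrite ffunE hpolyZ expr1.
  have [->|p0] := eqVneq (psi i (w i)) 0; first by rewrite scaler0 normr0 mulr0.
  by rewrite /GRing.scale /= -mulrA mulfVK.
have fz1 : \sum_i r i * `|psi i (w i)| <= 1.
  rewrite -fz -[f z]ger0_norm; last first.
    by rewrite fz sumr_ge0 // => i _; rewrite mulr_ge0 // ltW.
  apply: (le_trans (fq _)); apply/q_le/G_cst => // i.
  rewrite ffunE normrZ normrM gtr0_norm //
    mul1r -mulrA ler_piMr ?(ltW (r_gt0 i)) //.
  rewrite mulr_ile1 // normrM normfV normr_id.
  by have [->|p0] := eqVneq `|psi i (w i)| 0; rewrite ?mul0r // mulfV.
have : \sum_i r i * `|psi i| <= 1 + eta * S.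
  rewrite mulr_sumr -lerBlDr -sumrB (le_trans _ fz1) //; apply: ler_sum => i _.
  by rewrite (mulrC eta) -mulrBr ler_wpM2l // ?(ltW (r_gt0 i)) // ltW.
move=> /(le_trans fr); rewrite -lerBlDl => h.
have : eta * (1 + S) <= eta * S by rewrite /eta divfK ?gt_eqF // -/eta.
by rewrite ler_pM2l // gerDr ler10.
Qed.

End Helly.

(** * Polarization and evaluation functionals *)

Section Multilinear.
Context {K : numFieldType} {m : nat} {X Y : normedModType K}.
Variable A : ('I_m -> X) -> Y.
Hypothesis Al : multilinear A.

Lemma multilinear0 (x : 'I_m -> X) i : x i = 0 -> A x = 0.
Proof.
have {2}-> : x = dfwith x i (x i).
  apply/funext => l; have [<-|il] := eqVneq i l; first by rewrite dfwithin.
  by rewrite dfwithout.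
by move=> ->; have := Al i x (-1) 0 0;
  rewrite scaleN1r oppr0 addr0 scaleN1r addNr.
Qed.

Lemma multilinear_sum (I : finType) (i0 : I) (g : 'I_m -> I -> X) :
  A (fun i => \sum_l g i l) =
  \sum_(f : {ffun 'I_m -> I}) A (fun i => g i (f i)).
Proof.
(* [Q j f] keeps one representative [f] per choice in the first [j] slots. *)
pose Q j (f : {ffun 'I_m -> I}) := [forall i : 'I_m,
  (j <= i)%N ==> (f i == i0)].
have step j (h : 'I_m -> X) : (j <= m)%N ->
    A (fun i => if (i < j)%N then \sum_l g i l else h i) =
    \sum_(f | Q j f) A (fun i => if (i < j)%N then g i (f i) else h i).
  elim: j h => [|j IH] h jm.
    rewrite (big_pred1 [ffun=> i0]) // => f; apply/forallP/eqP => [fi|-> i].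
      by apply/ffunP => i; rewrite ffunE; exact/eqP/fi.
    by rewrite ffunE eqxx.
  pose i := Ordinal jm.
  have hyb (F : 'I_m -> X) : (fun l : 'I_m =>
    if (l < j.+1)%N then F l else h l) =
      (fun l : 'I_m => if (l < j)%N then F l else dfwith h i (F i) l).
    apply/funext => l; rewrite ltnS leq_eqVlt; have [<-|il] := eqVneq i l.
      by rewrite eqxx /= ltnn dfwithin.
    rewrite dfwithout // (_ : (l == j :> nat) = false) //.
    by rewrite eq_sym in il; apply/negbTE.
  have dfE (F : 'I_m -> X) u : (fun l : 'I_m =>
    if (l < j)%N then F l else dfwith h i u l) =
      dfwith (fun l : 'I_m => if (l < j)%N then F l else h l) i u.
    apply/funext => l; have [<-|il] := eqVneq i l.
      by rewrite !dfwithin /= ltnn.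
    by rewrite !dfwithout.
  rewrite hyb IH ?(ltnW jm) //.
  have sumE (F : 'I_m -> X) : A (dfwith F i (\sum_l g i l)) =
    \sum_l A (dfwith F i (g i l)).
    have := linear_lincomb (index_enum I) (fun=> 1) (g i) (Al i F).
    by under eq_bigr do rewrite scale1r; under [RHS]eq_bigr do rewrite scale1r.
  under eq_bigr do rewrite dfE sumE.
  rewrite exchange_big /= [RHS](partition_big (fun f : {ffun 'I_m -> I} =>
    f i) xpredT) //=.
  apply: eq_bigr => l _.
  (* Overwriting slot [i] by [l] matches the choices in the first [j] slots with the choices in
     [j.+1] slots whose value at [i] is [l]; [up i0] is the inverse. *)
  pose up l' (f : {ffun 'I_m -> I}) : {ffun 'I_m -> I} :=
    [ffun t => if t == i then l' else f t].
  rewrite [RHS](reindex_onto (up l) (up i0)) /=; last first.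
    move=> f /andP[_ /eqP fl]; apply/ffunP => t; rewrite !ffunE.
    by case: eqP => // ->.
  apply: eq_big => [f|f _].
    apply/idP/idP => [Qf|/andP[/andP[/forallP Qf _] /eqP fE]].
      rewrite ffunE eqxx eqxx andbT; apply/andP; split.
        apply/forallP => t; apply/implyP => jt; rewrite ffunE.
        rewrite (_ : t == i = false); first by move/forallP: Qf => /(_ t);
          rewrite (ltnW jt).
        by apply/negbTE; rewrite -val_eqE /= gtn_eqF.
      apply/eqP/ffunP => t; rewrite !ffunE; case: eqP => [->|//].
      by move/forallP: Qf => /(_ i) /=; rewrite leqnn => /eqP.
    apply/forallP => t; apply/implyP; rewrite leq_eqVlt => /orP[jt|jt].
      rewrite -fE !ffunE (_ : t == i) //.
      by rewrite -val_eqE /= eq_sym.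
    have := Qf t; rewrite jt ffunE (_ : t == i = false) //.
    by apply/negbTE; rewrite -val_eqE /= gtn_eqF.
  rewrite (hyb (fun t => g t (up l f t))) dfE; congr A; apply/funext => t.
  have [<-|it] := eqVneq i t; first by rewrite !dfwithin ffunE eqxx.
  by rewrite !dfwithout // ffunE eq_sym (negbTE it).
have := step m (fun=> 0) (leqnn m).
under eq_fun do rewrite ltn_ord.
move=> ->; apply: eq_big => [f|f _].
  by apply/forallP => i; rewrite leqNgt ltn_ord.
by congr A; apply/funext => i; rewrite ltn_ord.
Qed.

(** [b] encodes a subset of the slots; the sign is the parity of its complement. *)
Definition polar_sign (b : {ffun 'I_m -> bool}) : K := \prod_i (-1) ^+ (~~ b i).
Definition polar_point (x : 'I_m -> X) (b : {ffun 'I_m -> bool}) : X :=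
  \sum_i (b i)%:R *: x i.

(** The right-hand side is [m!] times the symmetrization of [A]. After expansion, the signs attached
    to [f] sum to a product over [i] whose factors vanish off the image of [f], so only surjective,
    hence injective, [f] survive. *)
Lemma polarization (x : 'I_m -> X) : (0 < m)%N ->
  \sum_b polar_sign b *: A (fun=> polar_point x b) =
  \sum_(f : {ffun 'I_m -> 'I_m} | injectiveb f) A (x \o f).
Proof.
move=> m0; pose i0 := Ordinal m0.
have AE b : A (fun=> polar_point x b) =
    \sum_(f : {ffun 'I_m -> 'I_m}) (\prod_i ((i \in codom f) ==> b i)%:R : K)
      *: A (x \o f).
  rewrite (multilinear_sum i0 (fun _ l => (b l)%:R *: x l));
    apply: eq_bigr => f _.
  have [/forallP bf|/forallPn[j bj]] := boolP [forall j, b (f j)].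
    rewrite big1 ?scale1r => [|i _].
      by congr A; apply/funext => j; rewrite bf scale1r.
    by case: codomP => //= -[j ->]; rewrite bf.
  rewrite (@multilinear0 _ j) ?(negbTE bj) ?scale0r //.
  by rewrite (bigD1 (f j)) //= codom_f (negbTE bj) /= mul0r scale0r.
under eq_bigr do rewrite AE scaler_sumr.
rewrite exchange_big /= [RHS]big_mkcond; apply: eq_bigr => f _.
under eq_bigr do rewrite scalerA -big_split /=.
rewrite -scaler_suml.
rewrite -(bigA_distr_bigA (fun i (c : bool) =>
  (-1) ^+ (~~ c) * ((i \in codom f) ==> c)%:R : K)) /=.
under eq_bigr do rewrite big_bool /= expr0 expr1 mul1r implybT implybF mulN1r.
have [/injectiveP finj|finj] := boolP (injectiveb f).
  by rewrite big1 ?scale1r // => i _; rewrite (injF_onto finj) subr0.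
suff [i /negbTE fi] : exists i, i \notin codom f.
  by rewrite (bigD1 i) //= fi subrr mul0r scale0r.
apply/existsP; apply: contraR finj; rewrite negb_exists => /forallP fsurj.
have finj : {in predT &, injective f}.
  by apply/image_injP/eqP/eq_card => i; have /negPn := fsurj i;
    rewrite inE => ->.
by apply/injectiveP => i j; apply: finj.
Qed.

Hypothesis A_bounded : forall r : K, exists C : K,
  forall x : 'I_m -> X, (forall i, `|x i| <= r) -> `|A x| <= C.

(** By homogeneity in slot [i], a nonzero [u] can be rescaled to norm [r], where [A_bounded]
    applies. *)
Lemma multilinear_slot_bounded (r : K) : 0 < r -> exists2 C : K, 0 < C &
  forall (x : 'I_m -> X) i u,
    (forall j, `|x j| <= r) -> `|A (dfwith x i u)| <= C * `|u|.
Proof.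
move=> r0; have [C AC] := A_bounded r.
have C0 : 0 <= C by apply: le_trans (normr_ge0 _) (AC (fun=> 0) _) => i;
  rewrite normr0 ltW.
exists (C / r + 1) => [|x i u xr]; first by rewrite ltr_pwDr // divr_ge0 // ltW.
have [->|u0] := eqVneq u 0.
  by rewrite (@multilinear0 _ i) ?dfwithin // !normr0 mulr0.
have nu0 : 0 < `|u| by rewrite normr_gt0.
have AZ a v : A (dfwith x i (a *: v)) = a *: A (dfwith x i v).
  have A0 : A (dfwith x i 0) = 0 by rewrite (@multilinear0 _ i) // dfwithin.
  by have := Al i x a v 0; rewrite addr0 A0 addr0.
pose v := (r / `|u|) *: u.
have uE : u = (`|u| / r) *: v.
  by rewrite scalerA mulrA divfK ?gt_eqF // mulfV ?scale1r // gt_eqF.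
have Av : `|A (dfwith x i v)| <= C.
  apply: AC => j; have [<-|ij] := eqVneq i j; last by rewrite dfwithout.
  by rewrite dfwithin normrZ gtr0_norm ?divr_gt0 // divfK // gt_eqF.
rewrite {1}uE AZ normrZ gtr0_norm ?divr_gt0 //.
rewrite (le_trans (ler_wpM2l _ Av)) ?divr_ge0 ?(ltW r0) //.
by rewrite mulrDl mul1r mulrC mulrA mulrAC lerDl.
Qed.

(** One passes from [y] to a nearby [x] one slot at a time; [multilinear_slot_bounded] controls each
    change. *)
Lemma multilinear_continuous : continuous (A : {ptws 'I_m -> X} -> Y).
Proof.
move=> y; apply/(@cvgrPdist_lt _ Y _ (nbhs y)) => eps eps0.
pose r := 1 + \sum_i `|y i|.
have r0 : 0 < r by rewrite ltr_pwDl // sumr_ge0.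
have [C C0 AC] := multilinear_slot_bounded r0.
(* The [m] changes cost at most [C * d] each; [1 + m] makes the total strictly less than [eps] and
   is nonzero even for [m = 0]. *)
pose d := eps / (C * (1 + m%:R)).
have m1 : 0 < 1 + m%:R :> K by rewrite ltr_pwDl.
have d0 : 0 < d by rewrite divr_gt0 // mulr_gt0.
have near_i i e : 0 < e -> \forall x \near (y : {ptws 'I_m -> X}),
  `|y i - x i| < e.
  move=> e0; have /(@cvgrPdist_lt _ X _ (nbhs y)) := @proj_continuous _ (fun=>
    X) i y.
  exact.
have near_all e : 0 < e -> \forall x \near (y : {ptws 'I_m -> X}), forall i,
  `|y i - x i| < e.
  by move=> e0; apply: (@filter_forall _ _ _ (nbhs (y : {ptws 'I_m -> X}))) =>
    i; exact: near_i.
near=> x.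
have xd i : `|y i - x i| < d by move: i; near: x; exact: near_all.
have x1 i : `|y i - x i| < 1 by move: i; near: x; exact: near_all.
have yr i : `|y i| <= r.
  by rewrite /r (bigD1 i) //= addrCA lerDl addr_ge0 // sumr_ge0.
have xr i : `|x i| <= r.
  rewrite -[x i](subrK (y i)) (le_trans (ler_normD _ _)) // /r lerD //.
    by rewrite distrC ltW.
  by rewrite (bigD1 i) //= lerDl sumr_ge0.
pose h (j : nat) (i : 'I_m) : X := if (i < j)%N then x i else y i.
have hr j i : `|h j i| <= r by rewrite /h; case: ifP.
have hstep j : (j < m)%N -> `|A (h j.+1) - A (h j)| <= C * d.
  move=> jm; pose i := Ordinal jm.
  have h1 : h j.+1 = dfwith (h j) i (x i).
    apply/funext => l; have [<-|il] := eqVneq i l;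
      first by rewrite dfwithin /h /= ltnSn.
    rewrite dfwithout // /h ltnS leq_eqVlt (_ : (l == j :> nat) = false) //.
    by rewrite eq_sym in il; apply/negbTE.
  have h0 : h j = dfwith (h j) i (y i).
    apply/funext => l; have [<-|il] := eqVneq i l; last by rewrite dfwithout.
    by rewrite dfwithin /h /= ltnn.
  have -> : A (h j.+1) - A (h j) = A (dfwith (h j) i (x i - y i)).
    rewrite h1 {2}h0 -scaleN1r addrC -Al scaleN1r addrC //.
  by rewrite (le_trans (AC _ _ _ (hr j))) // ler_pM2l // distrC ltW.
have hdist j : (j <= m)%N -> `|A (h j) - A y| <= j%:R * (C * d).
  elim: j => [_|j IH jm].
    by rewrite (_ : h 0 = y) ?subrr ?normr0 ?mul0r //; exact/funext.
  rewrite -[A (h j.+1)](subrK (A (h j))) -addrA (le_trans (ler_normD _ _)) //.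
  by rewrite mulrSr mulrDl mul1r [leRHS]addrC; apply: lerD;
    [exact: hstep|exact/IH/ltnW].
have hm : h m = x by apply/funext => i; rewrite /h ltn_ord.
rewrite distrC -hm (le_lt_trans (hdist m (leqnn m))) //.
have -> : m%:R * (C * d) = eps * (m%:R / (1 + m%:R)).
  by rewrite /d; field; rewrite !gt_eqF.
by rewrite gtr_pMr // ltr_pdivrMr // mul1r ltrDr.
Unshelve. all: by end_near. Qed.

End Multilinear.

Section Evaluation.
Context {R : realType} {k : scalar_kind}.
Local Notation K := (scalars R k).
Context {m : nat} {X : normedModType K}.
Local Notation Pm := (hpoly m X K^o).

Lemma is_hpoly_eval (x : X) : is_hpoly 1 (fun P : Pm => P x).
Proof.
apply: (@is_hpoly1_bounded _ _ _ _ (`|x| ^+ m)) => //; first exact: exprn_ge0.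
by move=> P; rewrite mulrC; exact: hpoly_normP.
Qed.

(** For [m = 1] this is the canonical embedding into the bidual. *)
Definition eval_at (x : X) : hpoly 1 Pm K^o := mk_hpoly (is_hpoly_eval x).

Lemma norm_eval_at x : `|eval_at x| <= `|x| ^+ m.
Proof.
apply: hpoly_norm_le => P P1; rewrite (le_trans (hpoly_normP P x)) //.
by rewrite ler_piMl // exprn_ge0.
Qed.

Let polar (x : 'I_m -> X) : hpoly 1 Pm K^o :=
  (m`!%:R)^-1 *: \sum_b polar_sign b *: eval_at (polar_point x b).

Let polarE (x : 'I_m -> X) (P : Pm) (A : ('I_m -> X) -> K^o) : (0 < m)%N ->
  multilinear A -> (forall x, P x = A (fun=> x)) ->
  polar x P = (m`!%:R)^-1 *
    (\sum_(f : {ffun 'I_m -> 'I_m} | injectiveb f) A (x \o f) : K) :> K.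
Proof.
move=> m0 Al PA; rewrite -(polarization Al x m0) /polar.
rewrite [LHS](_ : _ = (m`!%:R)^-1 *: ((\sum_b polar_sign b *: eval_at
  (polar_point x b)) P)) //.
by rewrite hpoly_lincombE; under eq_bigr do rewrite /= PA.
Qed.

(* The multilinear form is the polarization formula because a form witnessing
   [is_hpoly m P] does not depend linearly on [P], whereas this one does. *)
Lemma is_hpoly_eval_at : (0 < m)%N -> is_hpoly m eval_at.
Proof.
move=> m0; have polar_multi : multilinear polar.
  move=> i x a u v; apply: hpolyE => P.
  have [A [Al _ PA]] := hpolyP P.
  rewrite [RHS](_ : _ = a * (polar (dfwith x i u) P : K) + polar (dfwith x i v)
    P :> K) //.
  rewrite !(polarE _ m0 Al PA) mulrCA -mulrDr; congr (_ * _).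
  rewrite mulr_sumr -big_split /=; apply: eq_bigr => f /injectiveP finj.
  (* A permutation [f] reads slot [i] exactly once, at [invF finj i], so each term is linear in that
     slot. *)
  have fE w : dfwith x i w \o f = dfwith (x \o f) (invF finj i) w.
    apply/funext => l; have [<-|il] := eqVneq (invF finj i) l.
      by rewrite dfwithin /= f_invF dfwithin.
    rewrite dfwithout //= dfwithout //; apply: contra il => /eqP ->.
    by rewrite invF_f.
  by rewrite !fE Al.
exists polar; split=> // [|x].
  apply: multilinear_continuous => // r.
  exists (`|(m`!%:R)^-1| * \sum_(b : {ffun 'I_m -> bool}) (\sum_(i < m) r) ^+
    m) => x xr.
  rewrite normrZ ler_wpM2l // (le_trans (ler_norm_sum _ _ _)) // ler_sum //
    => b _.
  rewrite normrZ /polar_sign normr_prod big1 ?mul1r => [|i _]; last first.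
    by rewrite normrX normrN1 expr1n.
  rewrite (le_trans (norm_eval_at _)) // lerXn2r ?nnegrE //.
    by rewrite sumr_ge0 // => i _; rewrite (le_trans _ (xr i)).
  rewrite (le_trans (ler_norm_sum _ _ _)) // ler_sum // => i _.
  by rewrite normrZ; case: (b i);
    rewrite ?normr1 ?normr0 ?mul1r ?mul0r // (le_trans _ (xr i)).
apply: hpolyE => P; have [A [Al _ PA]] := hpolyP P.
rewrite (polarE _ m0 Al PA) /= PA.
under eq_bigr do rewrite (_ : (fun=> x) \o _ = (fun=> x)) //.
rewrite sumr_const -[#|_|]/(#|[pred f : {ffun 'I_m -> 'I_m} | injectiveb f]|).
have -> : #|[pred f : {ffun 'I_m -> 'I_m} | injectiveb f]| = m`!.
  by have := card_inj_ffuns 'I_m 'I_m; rewrite cardsE card_ord ffactnn.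
rewrite -(mulr_natl (A (fun=> x) : K)); apply/esym; apply: (@mulKf K).
by rewrite pnatr_eq0 -lt0n fact_gt0.
Qed.

End Evaluation.

(** * Finite rank *)

Section LinearAlgebra.
Context {K : numFieldType}.

(* Gaussian elimination on evaluation functionals: on a space spanned by [d]
   vectors, coordinates can be taken to be values at [d] points, so that they
   are continuous whenever evaluations are. *)
Lemma eval_coordinates (T : Type) (W : lmodType K) (ev : T -> W -> K^o) :
    (forall t, linear (ev t)) -> (forall w, (forall t, ev t w = 0) -> w = 0) ->
  forall e : seq W, exists2 s : seq (T * W), (size s <= size e)%N &
    forall w, w \in e -> w = \sum_(p <- s) ev p.1 w *: p.2.
Proof.
move=> evl ev_sep; elim=> [|w0 e [s se sE]]; first by exists [::].
pose S w := \sum_(p <- s) ev p.1 w *: p.2; pose w1 := w0 - S w0.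
have [w10|w1_neq0] := eqVneq w1 0.
  exists s => [|w]; first exact: (leq_trans se).
  by rewrite inE => /orP[/eqP ->|/sE //]; apply/eqP; rewrite -subr_eq0;
    exact/eqP.
have [t tw1] : exists t, ev t w1 != 0.
  apply: contrapT => nt; move/eqP: w1_neq0; apply; apply: ev_sep => t.
  by apply/eqP/negPn/negP => h; apply: nt; exists t.
(* [g] has value [1] at the pivot [t]; the earlier vectors are then corrected so as to vanish at
   [t]. *)
pose g := (ev t w1)^-1 *: w1.
exists ((t, g) :: [seq (p.1, p.2 - ev t p.2 *: g) | p <- s]) => [|w].
  by rewrite /= size_map ltnS.
have evB u v : ev t (u - v) = ev t u - ev t v.
  by rewrite addrC -scaleN1r evl scaleN1r addrC.
have -> : \sum_(p <- (t, g) :: [seq (p.1,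
  p.2 - ev t p.2 *: g) | p <- s]) ev p.1 w *: p.2
    = S w + ev t (w - S w) *: g.
  rewrite big_cons big_map /=; under eq_bigr do rewrite scalerBr scalerA.
  rewrite sumrB -scaler_suml evB scalerBl addrCA; congr (_ + (_ - _ *: _)).
  by rewrite [in RHS]/S (linear_lincomb _ _ _ (evl t)).
rewrite inE => /orP[/eqP ->|we]; last first.
  have -> : S w = w by rewrite /S -sE.
  by rewrite subrr -[0](subrr w) evB subrr scale0r addr0.
by rewrite -/w1 /g scalerA mulfV // scale1r /w1 addrC subrK.
Qed.

(** With more than [r] vectors the coefficient matrix has more rows than columns; a nonzero left
    kernel vector is a linear relation among the [s i]. *)
Lemma independent_leq (V : lmodType K) (r d : nat)
    (v : 'I_r -> V) (s : 'I_d -> V) :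
  (forall i, exists c : 'I_r -> K, s i = \sum_l c l *: v l) ->
  linearly_independent s -> (d <= r)%N.
Proof.
move=> /choice[c sE] s_ind; pose C := \matrix_(i, l) c i l.
rewrite leqNgt; apply/negP => rd.
have /rowV0Pn[u /sub_kermxP uC /negP] : kermx C != 0.
  rewrite kermx_eq0 /row_free neq_ltn (leq_ltn_trans _ rd) //;
    exact: rank_leq_col.
apply; apply/eqP/rowP => i; rewrite mxE; apply: (s_ind (u 0)).
under eq_bigr do rewrite sE scaler_sumr.
rewrite exchange_big big1 // => l _.
under eq_bigr do rewrite scalerA.
rewrite -scaler_suml -[RHS](scale0r (v l)); congr (_ *: _).
have /matrixP/(_ 0 l) := uC; rewrite !mxE => uCl; rewrite -[RHS]uCl.
by apply: eq_bigr => j _; rewrite mxE.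
Qed.

(** A basis is a linearly independent family in [S] of maximal length; [independent_leq] bounds that
    length by [r]. *)
Lemma has_dim_span (V : lmodType K) (r : nat) (v : 'I_r -> V) (S : set V) :
  (forall u, S u -> exists c : 'I_r -> K, u = \sum_l c l *: v l) ->
  exists2 d, (d <= r)%N & has_dim (linear_span S) d.
Proof.
move=> Sv.
pose P d := `[< exists s : 'I_d -> V, (forall i,
  S (s i)) /\ linearly_independent s >].
have P0 : exists d, P d.
  by exists 0; apply/asboolP; exists (fun=> 0); split=> [[]|c _ []].
have Pr d : P d -> (d <= r)%N.
  by move=> /asboolP[s [sS /independent_leq]]; apply => i; exact/Sv/sS.
have [d Pd dmax] := ex_maxnP P0 Pr.
exists d; first exact: Pr.
have [s [sS s_ind]] := asboolP _ Pd.
have s_span u : S u -> exists c : 'I_d -> K, u = \sum_l c l *: s l.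
  move=> Su; apply: contrapT => nu.
  suff /dmax : P d.+1 by rewrite ltnn.
  apply/asboolP; exists (fun i => if unlift ord0 i is Some j then s j else u).
  split=> [i|c]; first by case: unliftP.
  rewrite big_ord_recl unlift_none.
  under eq_bigr do rewrite liftK.
  have [c0|c0] := eqVneq (c ord0) 0.
    rewrite c0 scale0r add0r => /s_ind h i.
    by case: (unliftP ord0 i) => [j|] ->.
  move=> cu; case: nu; exists (fun l => - (c ord0)^-1 * c (lift ord0 l)).
  under eq_bigr do rewrite -scalerA.
  rewrite -scaler_sumr; move/eqP: cu; rewrite addrC addr_eq0 => /eqP ->.
  by rewrite scalerN scaleNr opprK scalerA mulVf // scale1r.
exists s; split=> //; apply/seteqP; split=> u [n [c [t [tS ->]]]].
  by exists n, c, t; split=> // i; have [l _ <-] := tS i.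
have [b tE] := choice (fun i => s_span _ (tS i)).
exists d, (fun l => \sum_i c i * b i l), s; split; first by move=> l; exists l.
under eq_bigr do rewrite tE scaler_sumr.
rewrite exchange_big; apply: eq_bigr => l _; rewrite scaler_suml.
by apply: eq_bigr => i _; rewrite scalerA.
Qed.

End LinearAlgebra.

(** * Finite nets of bounded scalars *)

Section Net.
Context {R : realType}.

Lemma real_net (M eta : R) : 0 < eta -> exists s : seq R,
  forall t, `|t| <= M -> exists2 a, a \in s & `|t - a| <= eta.
Proof.
(* The largest grid index is reached at [t = M]; the successor includes it in [iota 0 N]. *)
move=> eta0; pose N := (Num.truncn (2 * M / eta)).+1.
exists [seq i%:R * eta - M | i <- iota 0 N] => t;
  rewrite ler_norml => /andP[Mt tM].
have x0 : 0 <= (t + M) / eta by rewrite divr_ge0 ?(ltW eta0) // -lerBlDr sub0r.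
pose i := Num.truncn ((t + M) / eta).
exists (i%:R * eta - M).
  apply/mapP; exists i => //; rewrite mem_iota /= add0n ltnS; apply: le_truncn.
  by rewrite ler_pM2r ?invr_gt0 // mulr_natl mulr2n lerD2r.
have /andP[] := truncn_itv x0.
rewrite -/i ler_pdivlMr // ltr_pdivrMr // -natr1 mulrDl mul1r => h1 h2.
by rewrite ler_norml; apply/andP; split; lra.
Qed.

(** Over C, the product of two real nets with tolerance [eta / 2] works, since the modulus is at
    most the sum of the absolute values of the two parts. *)
Lemma scalars_net (k : scalar_kind) (M eta : scalars R k) : 0 < eta ->
  exists s : seq (scalars R k),
    forall t, `|t| <= M -> exists2 a, a \in s & `|t - a| <= eta.
Proof.
case: k M eta => /= M eta eta0; first exact: real_net.
have [eta' etaE eta'0] : exists2 e : R, eta = e%:C%C & 0 < e.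
  exists (complex.Re eta); last by move: eta0; rewrite ltcE => /andP[].
  by move: eta0; case: eta => a b; rewrite ltcE /= => /andP[/eqP + _];
    simpl => ->.
have [s sP] := real_net (complex.Re M) (divr_gt0 eta'0 (ltr0n R 2)).
exists [seq (a +i* b)%C | a <- s, b <- s] => t tM.
have norm_parts (z : R[i]) : `|z| <= (`|complex.Re z| + `|complex.Im z|)%:C%C.
  rewrite normc_def lecR -(ler_sqr) ?nnegrE ?sqrtr_ge0 ?addr_ge0 //.
  rewrite sqr_sqrtr ?addr_ge0 ?sqr_ge0 // sqrrD !real_normK ?num_real //.
  by rewrite lerD2r lerDl mulrn_wge0 // mulr_ge0.
have parts_norm (z : R[i]) : `|z| <= M ->
    `|complex.Re z| <= complex.Re M /\ `|complex.Im z| <= complex.Re M.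
  rewrite normc_def lecE /= => /andP[_ h].
  by split; apply: le_trans h;
    rewrite -sqrtr_sqr ler_wsqrtr // ?lerDl ?lerDr sqr_ge0.
have [/sP[a sa ta] /sP[b sb tb]] := parts_norm t tM.
exists (a +i* b)%C; first exact: allpairs_f.
rewrite (le_trans (norm_parts _)) // etaE lecR.
by case: t ta tb {tM} => x y /= ta tb; rewrite [eta']splitr lerD.
Qed.

End Net.

Lemma is_hpoly_linear_comp (K : numFieldType) (m : nat)
    (X Z Y : normedModType K) (f : X -> Z) (T : Z -> Y) :
  is_hpoly m f -> is_hpoly 1 T -> is_hpoly m (T \o f).
Proof.
move=> [A [Al Ac fA]] /is_hpoly1P[Tl Tc]; exists (T \o A);
  split=> [i x a u v|x|x].
- by rewrite /= Al Tl.
- exact: (@continuous_comp _ _ _ A T x (Ac x) (Tc _)).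
- by rewrite /= fA.
Qed.

(** * Finite-rank approximation of [P] from one of [P^**] *)

Section FiniteRankApproximation.
Context {R : realType} {k : scalar_kind}.
Local Notation K := (scalars R k).

Lemma hpoly1_normP (V W : normedModType K) (f : hpoly 1 V W) x :
  `|f x| <= `|f| * `|x|.
Proof. by have := hpoly_normP f x; rewrite expr1. Qed.

Lemma hpoly1B (V W : normedModType K) (f : hpoly 1 V W) u v :
  f (u - v) = f u - f v.
Proof. by rewrite addrC -scaleN1r hpoly1_linear scaleN1r addrC. Qed.

Lemma rank_lt0 (m : nat) (V W : normedModType K) (n : nat) : (0 < n)%N ->
  rank_lt (0 : hpoly m V W) n.
Proof.
move=> n0; have [_ [x _ <-]|d d0 dimd] := @has_dim_span K W 0 (fun=> 0) (range
  (0 : hpoly m V W)).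
  by exists (fun=> 0); rewrite big_ord0.
by exists d => //; rewrite (leq_ltn_trans d0).
Qed.

Context {m n : nat} {X Y : normedModType K} (m_gt0 : (0 < m)%N).
Local Notation dual V := (hpoly 1 V K^o).
Local Notation Pm := (hpoly m X K^o).

(** Points of [W] separate its dual, so [eval_coordinates] applies to a basis of the span of the
    range of [L]. *)
Lemma rank_lt_coordinates (V W : normedModType K) (L : hpoly 1 V (dual W)) :
  rank_lt L n -> exists r (t : 'I_r -> W) (w : 'I_r -> dual W), (r < n)%N /\
    forall xi, L xi = \sum_j L xi (t j) *: w j.
Proof.
move=> [d dn [e [_ eE]]].
have [//|w w0|s sd sE] := eval_coordinates (ev := fun (t : W) (w : dual W) => w
  t)
  _ _ [seq e i | i <- enum 'I_d].
  exact/hpolyE.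
exists (size s), (fun j => (tnth (in_tuple s) j).1),
  (fun j => (tnth (in_tuple s) j).2).
split=> [|xi]; first by rewrite (leq_ltn_trans sd) // size_map size_enum_ord.
rewrite -(big_tnth _ _ _ xpredT (fun p => L xi p.1 *: p.2)).
have : linear_span (range e) (L xi).
  rewrite eE; exists 1%N, (fun=> 1), (fun=> L xi); split=> [_|];
    first by exists xi.
  by rewrite big_ord1 scale1r.
move=> [q [c [v [ve ->]]]].
have vE i : v i = \sum_(p <- s) v i p.1 *: p.2.
  by apply: sE; have [l _ <-] := ve i; apply: map_f; rewrite mem_enum.
under [LHS]eq_bigr do rewrite vE scaler_sumr.
rewrite exchange_big; apply: eq_bigr => p _.
rewrite hpoly_lincombE scaler_suml; apply: eq_bigr => i _.
by rewrite scalerA.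
Qed.

Lemma finite_rank_approximation (P : hpoly m X Y)
    (L : hpoly 1 (dual Pm) (dual (dual Y))) (a g eps : K) :
    rank_lt L n -> `|adjoint (adjoint P) - L| <= a ->
    0 < g -> ball_coverable (P @` [set x | `|x| <= 1])%classic g -> 0 < eps ->
  exists2 Q : hpoly m X Y, rank_lt Q n & `|P - Q| <= a + 2 * g + eps.
Proof.
move=> /rank_lt_coordinates[r [t [w [rn LE]]]] PLa g0 [s [sg Ps]] eps0.
have a0 : 0 <= a by apply: le_trans PLa.
pose q j x : K := L (eval_at x) (t j).
pose T := \sum_j `|t j|.
have qM j x : `|x| <= 1 -> `|q j x| <= `|L| * T.
  move=> x1; rewrite (le_trans (hpoly1_normP _ _)) //.
  apply: ler_pM => //.
    by rewrite (le_trans (hpoly1_normP _ _)) // ler_piMr //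
      (le_trans (norm_eval_at _)) // exprn_ile1.
  by rewrite /T (bigD1 j) //= lerDl sumr_ge0.
pose E := \sum_j `|w j|.
have E0 : 0 <= E by apply: sumr_ge0.
(* Anticipates the bound [zB] on the vectors [z j], which are constructed only after [eta] is
   fixed. *)
pose B := \sum_j (2 * (`|w j| + 1)).
have B0 : 0 <= B by apply: sumr_ge0 => j _; rewrite mulr_ge0 // addr_ge0.
(* For [eta <= 1] the final error exceeds [a + 2 * g] by at most [eta * C]; the doubled [E] and [1]
   absorb the quadratic terms in [eta]. *)
pose C := g + a + 2 * E + 2 + B.
have C0 : 0 < C by rewrite !ltr_wpDr // ?mulr_ge0.
pose eta := eps / (C + eps).
have Ce0 : 0 < C + eps by rewrite addr_gt0.
have eta0 : 0 < eta by rewrite divr_gt0.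
have eta1 : eta <= 1 by rewrite ler_pdivrMr // mul1r lerDr ltW.
have etaC : eta * C <= eps.
  by rewrite /eta mulrAC ler_pdivrMr // ler_pM2l // lerDl ltW.
have [net netP] := scalars_net (`|L| * T) eta0.
(* The left summand of [I] fits the values of [Q] to the centers of the balls;
   the right one, with center [0] and a unit coefficient vector, bounds [z]. *)
pose I := (('I_(size s) * {ffun 'I_r -> 'I_(size net)}) + 'I_r)%type.
pose y (i : I) : Y :=
  match i with inl (i, _) => (tnth (in_tuple s) i).1 | inr _ => 0 end.
pose c (i : I) (j : 'I_r) : K :=
  match i with inl (_, f) => tnth (in_tuple net) (f j) | inr l =>
    (j == l)%:R end.
pose D (i : I) : dual (dual Y) := eval_at (y i) - \sum_j c i j *: w j.
have DE i (psi : dual Y) : psi (y i) - \sum_j c i j * w j psi = D i psi.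
  by rewrite [RHS](_ : _ = psi (y i) - (\sum_j c i j *: w j) psi) //
    hpoly_lincombE.
(* The added [eta] keeps the radii positive when [D i] vanishes. *)
have [||i psi|z zP] := @helly_bidual _ _ Y _ _ y c w (fun i =>
  `|D i| + eta) (1 + eta).
- by move=> i; rewrite ltr_wpDl.
- by rewrite ltrDl.
- by rewrite DE (le_trans (hpoly1_normP _ _)) // ler_wpM2r // lerDl ltW.
have zB j : `|z j| <= 2 * (`|w j| + 1).
  have := zP (inr j); rewrite /= sub0r normrN (bigD1 j) //= eqxx scale1r.
  rewrite big1 ?addr0 => [|l /negbTE ->]; last by rewrite scale0r.
  move=> /le_trans; apply; apply: ler_pM; rewrite ?addr_ge0 ?(ltW eta0) //.
    by rewrite lerD2l.
  apply: lerD => //; apply: hpoly_norm_le => psi psi1;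
    rewrite -DE /= hpoly0 // sub0r normrN.
  rewrite (bigD1 j) //= eqxx mul1r big1 ?addr0 => [|l /negbTE ->];
    last by rewrite mul0r.
  by rewrite (le_trans (hpoly1_normP _ _)) // ler_piMr.
have T_hp : is_hpoly 1 (fun xi => \sum_j L xi (t j) *: z j).
  apply: (@is_hpoly1_bounded _ _ _ _ (\sum_j `|L| * `|t j| * `|z j|)).
  - move=> b xi xi'; rewrite scaler_sumr -big_split /=; apply: eq_bigr => j _.
    rewrite hpoly1_linear [X in X *: _](_ : _ =
      b * L xi (t j) + L xi' (t j)) //.
    by rewrite scalerDl scalerA.
  - by apply: sumr_ge0 => j _; rewrite !mulr_ge0.
  - move=> xi; rewrite (le_trans (ler_norm_sum _ _ _)) //
    mulr_suml ler_sum // => j _.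
    rewrite normrZ mulrAC ler_wpM2r // (le_trans (hpoly1_normP _ _)) //.
    by rewrite mulrAC ler_wpM2r // hpoly1_normP.
pose Q : hpoly m X Y := mk_hpoly (is_hpoly_linear_comp (is_hpoly_eval_at m_gt0)
  T_hp).
exists Q.
  have [_ [x _ <-]|d dr dimd] := @has_dim_span K Y r z (range Q).
    by exists (fun j => q j x).
  by exists d => //; rewrite (leq_ltn_trans dr).
apply: hpoly_norm_le => x x1.
have [p /= ps] := Ps (P x) (ex_intro2 _ _ x x1 erefl).
rewrite -ball_normE /= => /ltW pPx.
have {}pPx : `|p.1 - P x| <= g.
  by rewrite (le_trans pPx) //; have /andP[] := sg _ ps.
have /(nthP (0, 0))[i0 i0s pE] := ps.
pose i : 'I_(size s) := Ordinal i0s.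
have iE : tnth (in_tuple s) i = p by rewrite (tnth_nth (0, 0)).
have f_ex j : exists l : 'I_(size net), `|q j x - tnth (in_tuple net) l| <= eta.
  have [b /(nthP 0)[l ln bE] qb] := netP _ (qM j x x1).
  by exists (Ordinal ln); rewrite (tnth_nth 0) /= bE.
have [f fE] := choice f_ex.
pose i' : I := inl (i, [ffun j => f j]).
have yi' : y i' = p.1 by rewrite /= iE.
have ci' j : `|q j x - c i' j| <= eta by rewrite /= ffunE.
(* [P^**] sends evaluation at [x] to evaluation at [P x]. The three terms are the distance to the
   center, the error of [L] and the rounding of the coefficients to the net. *)
have Di' : `|D i'| <= g + a + eta * E.
  have -> : D i' = eval_at (p.1 - P x) + (adjoint (adjoint P) - L) (eval_at x)
      + \sum_j (q j x - c i' j) *: w j.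
    apply: hpolyE => psi; rewrite -DE yi'.
    rewrite [RHS](_ : _ = psi (p.1 - P x) + (psi (P x) - L (eval_at x) psi)
      + (\sum_j (q j x - c i' j) *: w j) psi) //.
    rewrite hpoly1B subrKA LE !hpoly_lincombE.
    by under [X in _ = _ + X]eq_bigr do rewrite scalerBl; rewrite sumrB subrKA.
  rewrite (le_trans (ler_normD _ _)) // lerD //.
    rewrite (le_trans (ler_normD _ _)) // lerD //.
      by rewrite (le_trans (norm_eval_at _)) // expr1.
    rewrite (le_trans (hpoly1_normP _ _)) // (le_trans _ PLa) // ler_piMr //.
    by rewrite (le_trans (norm_eval_at _)) // exprn_ile1.
  rewrite (le_trans (ler_norm_sum _ _ _)) // mulr_sumr ler_sum // => j _.
  by rewrite normrZ ler_wpM2r.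
have zi' := zP i'.
have PQE : P x - Q x = (P x - p.1) + (p.1 - \sum_j c i' j *: z j)
    + \sum_j (c i' j - q j x) *: z j.
  by under [X in _ = _ + X]eq_bigr do rewrite scalerBl; rewrite sumrB !subrKA.
rewrite [X in `|X|](_ : _ = P x - Q x) // PQE.
have h1 : `|P x - p.1| <= g by rewrite distrC.
have h2 : `|p.1 - \sum_j c i' j *: z j| <= (1 + eta) * (g + a + eta * E + eta).
  rewrite -yi' (le_trans zi') // ler_wpM2l ?addr_ge0 ?(ltW eta0) //.
  by rewrite lerD2r.
have h3 : `|\sum_j (c i' j - q j x) *: z j| <= eta * B.
  rewrite (le_trans (ler_norm_sum _ _ _)) // mulr_sumr ler_sum // => j _.
  by rewrite normrZ ler_pM // distrC.
rewrite (le_trans (ler_normD _ _)) // (le_trans (lerD (ler_normD _ _) h3)) //.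
rewrite (le_trans (lerD (lerD h1 h2) (lexx _))) //.
have h4 : eta * (1 - eta) * (E + 1) >= 0.
  by apply: mulr_ge0; [apply: mulr_ge0;
    rewrite ?subr_ge0 // ltW|exact: addr_ge0].
rewrite -subr_ge0.
have -> : a + 2 * g + eps - (g + (1 + eta) * (g + a + eta * E + eta) + eta * B)
  =
   eta * (1 - eta) * (E + 1) + (eps - eta * C).
  by rewrite /C; ring.
by rewrite addr_ge0 // subr_ge0.
Qed.

End FiniteRankApproximation.

Theorem proposition4p5 (R : realType) (k : scalar_kind) (m : nat)
    (m_ge2 : (2 <= m)%N) (X Y : completeNormedModType (scalars R k))
    (n : nat) (n_gt0 : (0 < n)%N) (P : hpoly m X Y) :
  approx_number n P <=
    approx_number n (adjoint (adjoint P)) + 2 * gamma_tilde P.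
Proof.
have m_gt0 : (0 < m)%N by exact: leq_trans m_ge2.
have gamma_lt e : 0 < e -> exists2 g : scalars R k,
    0 < g /\ ball_coverable (P @` [set x | `|x| <= 1])%classic g & g <
      gamma_tilde P + e.
  move=> e0; apply: infimum_lt; last by rewrite ltrDl.
    have P1 : 0 < `|P| + 1 by rewrite ltr_wpDl.
    exists (`|P| + 1); split=> //; exists [:: (0, `|P| + 1)];
      split=> [p|_ [x /= x1 <-]].
      by rewrite inE => /eqP -> /=; rewrite P1 lexx.
    exists (0, `|P| + 1); first by rewrite /= inE.
    by rewrite -ball_normE /= sub0r normrN ltr_pwDr // hpoly_norm_ub.
  by move=> x [/ltW].
have approx_lt e : 0 < e -> exists2 L, rank_lt L n &
    `|adjoint (adjoint P) - L| < approx_number n (adjoint (adjoint P)) + e.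
  move=> e0; set A := adjoint _.
  suff [_ [L Ln <-] AL] : exists2 b,
    [set `|A - L| | L in [set L | rank_lt L n]]%classic b &
      b < approx_number n A + e by exists L.
  apply: infimum_lt; last by rewrite ltrDl.
    (* As [n] is positive, the zero map is a competitor, so the infimum runs over a nonempty set. *)
    by exists `|A - 0|, 0 => //; exact: rank_lt0.
  by move=> _ [L _ <-].
apply/ler_addgt0Pr => eps eps0.
(* Four shares: one for the approximation of [P^**], two for the doubled radius, one for
   [finite_rank_approximation]. *)
pose e := eps / 4; have e0 : 0 < e by rewrite divr_gt0.
have [g [g0 Pg] gP] := gamma_lt e e0.
have [L Ln /ltW PL] := approx_lt e e0.
have [Q Qn PQ] := finite_rank_approximation m_gt0 Ln PL g0 Pg e0.
have : approx_number n P <= `|P - Q|.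
  by apply: infimum_le; [exists `|P - Q|, Q|move=> _ [? _ <-]|exists Q].
move=> /le_trans; apply; apply: (le_trans PQ).
have epsE : eps = 4 * e by rewrite /e mulrC divfK // pnatr_eq0.
rewrite -subr_ge0 epsE; set A := approx_number n _.
have -> : A + 2 * gamma_tilde P + 4 * e - (A + e + 2 * g + e) =
    2 * (gamma_tilde P + e - g) by ring.
by rewrite mulr_ge0 // subr_ge0 ltW.
Qed.
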